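(* Let $A$ be a bounded operator on a complex Banach space with $\sigma(A)=[-1,1]$. Then \begin{itemize} \item $P_{\sigma(A)}(A)\le P_{\{-1,1\}}(A)$; \item $M(A)\le e\,P_{\{-1,1\}}(A)^2\le 2e\,P_{\sigma(A)}(A)^2$. \end{itemize}
   Context: For a bounded operator $A$ with spectrum $\sigma(A)$ contained in the closed unit disk, $M(A)=\sup_{n\ge0}\|A^n\|$ (over integers $n\ge 0$, with $A^0=I$). For a nonempty set $S\subseteq\sigma(A)$, $P_S(A)=\sup_{|\lambda|>1}\mathrm{dist}(\lambda,S)\,\|(\lambda I-A)^{-1}\|$. Suprema take values in $[0,+\infty]$; here $e$ is Euler's number. *)

(* Defs.v *)
(* A complex Banach space is a
   [CompleteNormedModule C_AbsRing]; a bounded operator on it is a function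
   satisfying Coquelicot's [is_linear], which includes boundedness. *)
From Stdlib Require Import Reals ClassicalEpsilon.
From Coquelicot Require Import Coquelicot.

Open Scope R_scope.

Definition op_pow {V : Type} (A : V -> V) (n : nat) : V -> V :=
  fun x => Nat.iter n A x.

Definition op_norm {V : CompleteNormedModule C_AbsRing} (T : V -> V) : Rbar :=
  Lub_Rbar (fun r => exists x : V, norm x <= 1 /\ r = norm (T x)).

Definition shift {V : CompleteNormedModule C_AbsRing}
    (A : V -> V) (l : C) : V -> V :=
  fun x => minus (scal l x) (A x).

Definition is_op_inverse {V : CompleteNormedModule C_AbsRing}
    (T B : V -> V) : Prop :=
  is_linear B /\ (forall x, B (T x) = x) /\ (forall x, T (B x) = x).

Definition spectrum {V : CompleteNormedModule C_AbsRing}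
    (A : V -> V) : C -> Prop :=
  fun l => ~ exists B : V -> V, is_op_inverse (shift A l) B.

(* For [l] outside the spectrum this is the (unique) bounded inverse of
   [l I - A]; the value is unspecified on the spectrum. *)
Definition resolvent {V : CompleteNormedModule C_AbsRing}
    (A : V -> V) (l : C) : V -> V :=
  epsilon (inhabits (fun x : V => x)) (is_op_inverse (shift A l)).

Definition dist_set (l : C) (S : C -> Prop) : Rbar :=
  Glb_Rbar (fun r => exists s : C, S s /\ r = Cmod (l - s)%C).

Definition M_const {V : CompleteNormedModule C_AbsRing} (A : V -> V) : Rbar :=
  Sup_seq (fun n => op_norm (op_pow A n)).

(* Meaningful for [S] nonempty and the spectrum of [A] inside the closed unit
   disk, so that [resolvent A l] is the true resolvent for every [l] below. *)
Definition P_const {V : CompleteNormedModule C_AbsRing}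
    (S : C -> Prop) (A : V -> V) : Rbar :=
  Rbar_lub (fun y => exists l : C, 1 < Cmod l /\
    y = Rbar_mult (dist_set l S) (op_norm (resolvent A l))).

Definition segment_m1_1 : C -> Prop :=
  fun z => exists t : R, -1 <= t <= 1 /\ z = RtoC t.

Definition pair_m1_1 : C -> Prop :=
  fun z => z = RtoC (-1) \/ z = RtoC 1.

(* Main.v *)
Require Import Defs.
From Stdlib Require Import Reals Lra Lia ClassicalEpsilon.
From Coquelicot Require Import Coquelicot.

(** Write [R(l)] for the resolvent and [d(l)] for the distance from [l] to
    [{-1, 1}], and suppose [d(l) |R(l)| <= P] outside the unit disk. Integrating
    the Cauchy formula for [A ^ n] by parts gives
    [(n + 1) A ^ n = 1 / (2 i PI) * integral of l ^ (n + 1) R(l) ^ 2 dl] over the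
    circle of radius [r > 1]. Since
    [1 / d(l) ^ 2 <= 1 / |l - 1| ^ 2 + 1 / |l + 1| ^ 2] and both terms have mean
    [1 / (r ^ 2 - 1)] over the circle (Poisson kernel), this yields
    [(n + 1) |A ^ n| <= 2 r ^ (n + 2) / (r ^ 2 - 1) P ^ 2].
    For [r = 1 + 1 / n] the resulting bound on [|A ^ n|] is
    [(1 + 1 / n) ^ n (2 n + 2) / (2 n + 1) P ^ 2], at most [e P ^ 2]
    ([pow_midpoint_le_exp_1]).

    The integrals are replaced by averages over [N] equally spaced points
    [l_k] of the circle, with [N] tending to infinity at the end
    ([norm_pow_le_radius]). The average [y] of [l_k ^ (n + 1) R(l_k) x] satisfies
    [y - (A / r) ^ N y = A ^ n x] exactly ([discrete_cauchy]); the same identity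
    for multiplication by a number gives the Poisson sums ([poisson_sum]).
    Integration by parts becomes summation by parts, in which the first
    resolvent identity turns differences of neighbouring resolvents into products
    ([norm_circle_mean_le]).

    The aliasing term [(A / r) ^ N y] vanishes in the limit because the spectral
    radius is at most [1]. This is proved without holomorphy
    ([decay_outside_disk]): [l R(l)] is Lipschitz on [|l| >= r], so the
    averages of [l R(l)] over [N] points of two close circles are close, uniformly
    in [N]. They are the inverses of [1 - (A / l) ^ N] for the two radii [l]. If
    the powers of [A] decay relative to the larger radius, the average there tends
    to the identity, hence [(A / l) ^ N] stays bounded on the smaller one. Steps of
    a fixed length lead from [|A|] down to any [r > 1].

    The comparisons between the two constants come from comparing distances:
    the distance to [[-1, 1]] is at most [d(l)], and [d(l)] is at most [sqrt 2]
    times it when [|l| > 1] ([dist_pm1_le_sqrt2]). *)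

(** * Roots of unity *)

(** The primitive root of unity [exp (2 i PI / N)], for [N] positive. *)
Definition omega (N : nat) : C :=
  (cos (2 * PI / INR N), sin (2 * PI / INR N)).

Lemma omega_pow (N k : nat) :
  (omega N ^ k)%C = (cos (INR k * (2 * PI / INR N)), sin (INR k * (2 * PI / INR N))).
Proof.
  induction k as [|k IH].
  - simpl INR. rewrite Rmult_0_l, cos_0, sin_0. reflexivity.
  - rewrite Cpow_S, IH, S_INR.
    unfold omega, Cmult; simpl.
    rewrite Rmult_plus_distr_r, Rmult_1_l, cos_plus, sin_plus.
    f_equal; ring.
Qed.

Lemma omega_pow_order (m : nat) : (omega (S m) ^ S m)%C = 1%C.
Proof.
  rewrite omega_pow.
  replace (INR (S m) * (2 * PI / INR (S m))) with (2 * PI)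
    by (field; apply not_0_INR; lia).
  rewrite cos_2PI, sin_2PI. reflexivity.
Qed.

Lemma omega_pow_neq_1 (m j : nat) :
  (0 < j < S m)%nat -> (omega (S m) ^ j)%C <> 1%C.
Proof.
  intros Hj Heq. rewrite omega_pow in Heq.
  set (t := INR j * (2 * PI / INR (S m))) in Heq.
  assert (Hc : cos t = 1) by (now injection Heq).
  assert (HN : 0 < INR (S m)) by (apply lt_0_INR; lia).
  assert (H0 : 0 < INR j) by (apply lt_0_INR; lia).
  assert (H1 : INR j < INR (S m)) by (apply lt_INR; lia).
  assert (HPI := PI_RGT_0).
  assert (Ht : 0 < t / 2 < PI).
  { replace (t / 2) with (PI * (INR j / INR (S m))) by (unfold t; field; lra).
    assert (0 < INR j / INR (S m)) by (now apply Rdiv_lt_0_compat).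
    assert (INR j / INR (S m) < 1) by (apply Rlt_div_l; lra).
    split; [now apply Rmult_lt_0_compat|nra]. }
  assert (Hs : 0 < sin (t / 2)) by (apply sin_gt_0; lra).
  assert (Hd : cos t = 1 - 2 * sin (t / 2) * sin (t / 2)).
  { rewrite <- cos_2a_sin. f_equal. lra. }
  nra.
Qed.

Lemma Cmod_omega (N : nat) : Cmod (omega N) = 1.
Proof.
  unfold Cmod, omega; simpl.
  rewrite !Rmult_1_r.
  generalize (sin2_cos2 (2 * PI / INR N)); unfold Rsqr; intros H.
  replace (_ + _) with 1 by lra. apply sqrt_1.
Qed.

Lemma Cmod_omega_pow (N k : nat) : Cmod (omega N ^ k) = 1.
Proof. rewrite Cmod_pow, Cmod_omega, pow1. reflexivity. Qed.

Lemma sum_geom_C (w : C) (m : nat) :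
  ((w - 1) * @sum_n C_Ring (fun k => w ^ k) m)%C = (w ^ S m - 1)%C.
Proof.
  induction m as [|m IH].
  - rewrite sum_O. simpl. ring.
  - rewrite sum_Sn. change (@plus C_Ring) with Cplus.
    rewrite Cmult_plus_distr_l, IH, !Cpow_S. ring.
Qed.

Lemma sum_root_of_unity (w : C) (m : nat) :
  (w ^ S m)%C = 1%C -> w <> 1%C -> @sum_n C_Ring (fun k => w ^ k)%C m = RtoC 0.
Proof.
  intros Hw H1.
  assert (H := sum_geom_C w m). rewrite Hw in H.
  assert (Hn : (w - 1)%C <> 0%C).
  { intros H0. apply H1. replace w with ((w - 1) + 1)%C by ring. rewrite H0. ring. }
  assert (Hs : forall s : C, ((w - 1) * s)%C = (1 - 1)%C -> s = 0%C).
  { intros s E. transitivity (/ (w - 1) * ((w - 1) * s))%C; [now field|].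
    rewrite E. ring. }
  exact (Hs _ H).
Qed.

(** The [k]-th of the [N] equally spaced points of the circle of radius [r]. *)
Definition circ (r : R) (N k : nat) : C := (RtoC r * omega N ^ k)%C.

Lemma Cmod_circ (r : R) (N k : nat) : 0 <= r -> Cmod (circ r N k) = r.
Proof.
  intros Hr. unfold circ.
  rewrite Cmod_mult, Cmod_omega_pow, Cmod_R, Rabs_pos_eq; lra.
Qed.

Lemma circ_period (r : R) (m : nat) : circ r (S m) (S m) = circ r (S m) 0.
Proof. unfold circ. now rewrite omega_pow_order. Qed.

(** Positive powers of order below [2 N] other than [N] average to [0] over the
    [N] points. *)
Lemma sum_circ_pow (r : R) (m q : nat) :
  (0 < q < 2 * S m)%nat -> q <> S m ->
  @sum_n C_Ring (fun k => circ r (S m) k ^ q)%C m = RtoC 0.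
Proof.
  intros Hq HN.
  rewrite (sum_n_ext _ (fun k => @mult C_Ring (RtoC r ^ q)%C ((omega (S m) ^ q) ^ k)%C)).
  2:{ intros k. unfold circ. change (@mult C_Ring) with Cmult.
      rewrite Cpow_mult_l, <- !Cpow_mult_r, (Nat.mul_comm k q). reflexivity. }
  rewrite sum_n_mult_l, sum_root_of_unity.
  - apply Cmult_0_r.
  - rewrite <- Cpow_mult_r, Nat.mul_comm, Cpow_mult_r, omega_pow_order, Cpow_1_l.
    reflexivity.
  - destruct (Nat.lt_ge_cases q (S m)).
    + apply omega_pow_neq_1; lia.
    + replace q with (S m + (q - S m))%nat by lia.
      rewrite Cpow_add_r, omega_pow_order, Cmult_1_l.
      apply omega_pow_neq_1; lia.
Qed.

Lemma sum_circ_pow_order (r : R) (m : nat) :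
  @sum_n C_Ring (fun k => circ r (S m) k ^ S m)%C m = (RtoC (INR (S m)) * RtoC r ^ S m)%C.
Proof.
  assert (H : forall k, (circ r (S m) k ^ S m)%C = (RtoC r ^ S m)%C).
  { intros k. unfold circ. rewrite Cpow_mult_l, <- Cpow_mult_r, Nat.mul_comm.
    rewrite Cpow_mult_r, omega_pow_order, Cpow_1_l. ring. }
  rewrite (sum_n_ext _ (fun _ => (RtoC r ^ S m)%C)) by exact H.
  generalize (RtoC r ^ S m)%C. intros c. clear.
  induction m as [|m IH].
  - rewrite sum_O. simpl. ring.
  - rewrite sum_Sn, IH, (S_INR (S m)), RtoC_plus.
    set (p := INR (S m)). change (@eq C (p * c + c)%C ((p + RtoC 1) * c)%C). ring.
Qed.

(** * The discrete Cauchy formula *)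

Section Averages.

Context {V : NormedModule C_AbsRing}.

Lemma op_pow_linear (A : V -> V) (n : nat) : is_linear A -> is_linear (op_pow A n).
Proof.
  intros hA. induction n as [|n IH].
  - apply is_linear_id.
  - apply (is_linear_comp (op_pow A n) A IH hA).
Qed.

Lemma linear_sum_n (B : V -> V) (u : nat -> V) (m : nat) :
  is_linear B -> B (sum_n u m) = sum_n (fun k => B (u k)) m.
Proof.
  intros hB. induction m as [|m IH].
  - now rewrite !sum_O.
  - now rewrite !sum_Sn, (linear_plus B hB), IH.
Qed.

(** Factorization of [l ^ (m + 1) - A ^ (m + 1)] by [l - A]. *)
Lemma op_pow_geom (A : V -> V) (l : C) (v x : V) (m : nat) :
  is_linear A -> minus (scal l v) (A v) = x ->
  minus (scal (l ^ S m)%C v) (op_pow A (S m) v)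
  = sum_n (fun j => scal (l ^ (m - j))%C (op_pow A j x)) m.
Proof.
  intros hA Hx. induction m as [|m IH].
  - rewrite sum_O. simpl. rewrite Cmult_1_r, Hx. now rewrite (scal_one (V:=V)).
  - rewrite sum_Sn.
    rewrite (sum_n_ext_loc _ (fun j => scal l (scal (l ^ (m - j))%C (op_pow A j x)))).
    2:{ intros j Hj. rewrite scal_assoc. replace (S m - j)%nat with (S (m - j)) by lia.
        reflexivity. }
    rewrite sum_n_scal_l, <- IH.
    rewrite Nat.sub_diag. simpl (l ^ 0)%C. rewrite (scal_one (V:=V)).
    rewrite <- Hx at 1.
    rewrite (linear_minus _ _ _ (op_pow_linear A (S m) hA)).
    rewrite (linear_scal _ (op_pow_linear A (S m) hA)).
    rewrite scal_minus_distr_l, scal_assoc.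
    change (@mult (AbsRing.Ring C_AbsRing)) with Cmult. rewrite <- Cpow_S.
    replace (op_pow A (S m) (A v)) with (op_pow A (S (S m)) v).
    2:{ unfold op_pow. now rewrite (Nat.iter_succ_r (S m)). }
    unfold minus. rewrite <- !plus_assoc. f_equal.
    now rewrite plus_assoc, (plus_opp_l (G:=V)), plus_zero_l.
Qed.

(** The average over [m + 1] equally spaced points of the circle of radius
    [r]. *)
Definition circle_mean (f : C -> V) (r : R) (m : nat) : V :=
  scal (RtoC (/ INR (S m))) (sum_n (fun k => f (circ r (S m) k)) m).

Lemma is_linear_shift (B : V -> V) (c : C) :
  is_linear B -> is_linear (fun x => minus (scal c x) (B x)).
Proof.
  intros hB.
  apply (is_linear_comp (fun x => (scal c x, opp (B x))) (fun p => plus (fst p) (snd p))).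
  - apply is_linear_prod.
    + apply (is_linear_scal_r (V := V) c). exact Cmult_comm.
    + apply (is_linear_comp B _ hB). apply is_linear_opp.
  - apply is_linear_plus.
Qed.

Lemma linear_circle_mean (B : V -> V) (f : C -> V) (r : R) (m : nat) :
  is_linear B -> B (circle_mean f r m) = circle_mean (fun l => B (f l)) r m.
Proof.
  intros hB. unfold circle_mean.
  now rewrite (linear_scal _ hB), (linear_sum_n _ _ _ hB).
Qed.

Lemma circle_mean_ext (f g : C -> V) (r : R) (m : nat) :
  (forall k, f (circ r (S m) k) = g (circ r (S m) k)) ->
  circle_mean f r m = circle_mean g r m.
Proof. intros H. unfold circle_mean. apply f_equal. now apply sum_n_ext. Qed.

(** If [v l] solves [(l - A) (v l) = x], then the average [y] of
    [l ^ (n + 1) v l] over [N = m + 1] points is [A ^ n x] up to the aliasing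
    term [(A / r) ^ N y]. *)
Lemma discrete_cauchy (A : V -> V) (v : C -> V) (x : V) (r : R) (m n : nat) :
  is_linear A -> (n <= m)%nat ->
  (forall k, minus (scal (circ r (S m) k) (v (circ r (S m) k)))
               (A (v (circ r (S m) k))) = x) ->
  let y := circle_mean (fun l => scal (l ^ S n)%C (v l)) r m in
  minus (scal (RtoC r ^ S m)%C y) (op_pow A (S m) y)
  = scal (RtoC r ^ S m)%C (op_pow A n x).
Proof.
  intros hA Hn Hv y.
  set (N := S m) in *. set (c := RtoC (/ INR N)).
  assert (HN : RtoC (INR N) <> 0%C).
  { intros H. apply RtoC_inj in H. revert H. apply not_0_INR. unfold N; lia. }
  assert (HrN : forall k, (circ r N k ^ N)%C = (RtoC r ^ N)%C).
  { intros k. unfold circ, N. rewrite Cpow_mult_l, <- Cpow_mult_r, Nat.mul_comm.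
    rewrite Cpow_mult_r, omega_pow_order, Cpow_1_l. ring. }
  assert (hAN := op_pow_linear A N hA).
  set (T := fun z : V => minus (scal (RtoC r ^ N)%C z) (op_pow A N z)).
  assert (hT : is_linear T) by (now apply is_linear_shift).
  change (T y = scal (RtoC r ^ N)%C (op_pow A n x)).
  unfold y. rewrite (linear_circle_mean _ _ _ _ hT).
  unfold circle_mean. fold N c.
  (* each term is a finite geometric sum in [A] *)
  rewrite (sum_n_ext _ (fun k => sum_n (fun j =>
    scal (circ r N k ^ (S n + (m - j)))%C (op_pow A j x)) m)).
  2:{ intros k. rewrite (linear_scal _ hT). unfold T. rewrite <- (HrN k).
      assert (Hg := op_pow_geom A (circ r N k) _ x m hA (Hv k)). fold N in Hg.
      rewrite Hg, <- (sum_n_scal_l (V:=V)). apply sum_n_ext. intros j.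
      rewrite scal_assoc, Cpow_add_r. reflexivity. }
  rewrite (sum_n_switch (G:=V)).
  (* only the index [j = n] survives the average *)
  assert (Hterm : forall j, (j <= m)%nat ->
    sum_n (fun k => scal (circ r N k ^ (S n + (m - j)))%C (op_pow A j x)) m
    = if Nat.eq_dec j n then scal (RtoC (INR N) * RtoC r ^ N)%C (op_pow A n x) else zero).
  { intros j Hj.
    assert (Hs : forall (u : nat -> C) (z : V) p,
      sum_n (fun k => scal (u k) z) p = scal (@sum_n C_Ring u p) z).
    { intros u z p. induction p as [|p IH]; [now rewrite !sum_O|].
      rewrite !sum_Sn, IH. now rewrite <- (scal_distr_r (V:=V)). }
    rewrite (Hs (fun k => circ r N k ^ (S n + (m - j)))%C).
    destruct (Nat.eq_dec j n) as [->|Hjn].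
    - replace (S n + (m - n))%nat with (S m) by lia.
      unfold N at 1. rewrite sum_circ_pow_order. reflexivity.
    - unfold N. rewrite sum_circ_pow by lia. apply (scal_zero_l (V:=V)). }
  etransitivity; [apply f_equal; exact (sum_n_ext_loc _ _ _ Hterm)|].
  assert (Hd : forall (z : V) p, (n <= p)%nat ->
    sum_n (fun j => if Nat.eq_dec j n then z else zero) p = z).
  { intros z p. assert (H0 : forall q, (q < n)%nat ->
      sum_n (fun j => if Nat.eq_dec j n then z else zero) q = zero).
    { induction q as [|q IH]; intros Hq.
      - rewrite sum_O. destruct (Nat.eq_dec 0 n); [lia|reflexivity].
      - rewrite sum_Sn, IH by lia. destruct (Nat.eq_dec (S q) n); [lia|].
        apply plus_zero_l. }
    induction p as [|p IH]; intros Hp.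
    - rewrite sum_O. destruct (Nat.eq_dec 0 n); [reflexivity|lia].
    - rewrite sum_Sn. destruct (Nat.eq_dec (S p) n) as [e|e].
      + rewrite H0 by lia. apply plus_zero_l.
      + rewrite IH by lia. apply plus_zero_r. }
  rewrite Hd by exact Hn.
  rewrite scal_assoc. f_equal.
  change (@mult (AbsRing.Ring C_AbsRing)) with Cmult. unfold c.
  rewrite RtoC_inv.
  - change (@eq C (/ RtoC (INR N) * (RtoC (INR N) * RtoC r ^ N))%C (RtoC r ^ N)%C).
    now field.
  - apply not_0_INR. unfold N; lia.
Qed.

(** * Norms *)

Lemma norm_minus_le (x y : V) : norm (minus x y) <= norm x + norm y.
Proof.
  unfold minus. eapply Rle_trans; [apply (norm_triangle (V := V))|].
  rewrite (norm_opp (V := V)). lra.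
Qed.

Lemma norm_scal_C (l : C) (x : V) : norm (scal l x) = Cmod l * norm x.
Proof.
  assert (Hle : forall (c : C) (z : V), norm (scal c z) <= Cmod c * norm z)
    by (intros; apply (norm_scal (V := V))).
  apply Rle_antisym; [apply Hle|].
  destruct (Req_dec (Cmod l) 0) as [H0|H0].
  - rewrite H0, Rmult_0_l. apply (norm_ge_0 (V := V)).
  - assert (Hp : 0 < Cmod l) by (generalize (Cmod_ge_0 l); lra).
    assert (Hl : l <> 0%C) by (intros H; apply H0; rewrite H; apply Cmod_0).
    assert (H := Hle (/ l)%C (scal l x)).
    rewrite scal_assoc, Cmod_inv in H by exact Hl.
    replace (mult (/ l)%C l) with (one : C_Ring) in H by (symmetry; now apply Cinv_l).
    rewrite (scal_one (V := V)) in H.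
    apply Rmult_le_compat_l with (r := Cmod l) in H; [|lra].
    rewrite <- Rmult_assoc, Rinv_r, Rmult_1_l in H by exact H0. exact H.
Qed.

Lemma norm_sum_n_le (u : nat -> V) (b : nat -> R) (m : nat) :
  (forall k, (k <= m)%nat -> norm (u k) <= b k) -> norm (sum_n u m) <= sum_n b m.
Proof.
  induction m as [|m IH]; intros H.
  - rewrite !sum_O. apply H. lia.
  - rewrite !sum_Sn. eapply Rle_trans; [apply (norm_triangle (V := V))|].
    apply Rplus_le_compat; [apply IH; intros; apply H; lia|apply H; lia].
Qed.

Lemma norm_circle_mean_minus_le (f g : C -> V) (r s b : R) (m : nat) :
  (forall k, norm (minus (f (circ r (S m) k)) (g (circ s (S m) k))) <= b) ->
  norm (minus (circle_mean f r m) (circle_mean g s m)) <= b.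
Proof.
  intros H. unfold circle_mean.
  set (N := S m) in *.
  assert (HN : 0 < INR N) by (apply lt_0_INR; unfold N; lia).
  rewrite <- (scal_minus_distr_l (V := V)).
  rewrite norm_scal_C, Cmod_R, Rabs_pos_eq
    by (apply Rlt_le, Rinv_0_lt_compat; exact HN).
  apply Rmult_le_reg_l with (INR N); [exact HN|].
  rewrite <- Rmult_assoc, Rinv_r, Rmult_1_l by lra.
  unfold N at 3. rewrite <- (sum_n_const m b).
  replace (minus _ _) with
    (sum_n (fun k => minus (f (circ r N k)) (g (circ s N k))) m).
  - now apply norm_sum_n_le.
  - unfold minus. rewrite (sum_n_plus (G := V)). f_equal.
    rewrite <- (scal_opp_one (V := V)), <- (sum_n_scal_l (V := V)).
    apply sum_n_ext. intros k. symmetry. apply (scal_opp_one (V := V)).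
Qed.

(** * Resolvents *)

(** [B] is a bounded two-sided inverse of [l - A]. *)
Definition is_resolvent (A : V -> V) (l : C) (B : V -> V) : Prop :=
  is_linear B /\
  (forall x, B (minus (scal l x) (A x)) = x) /\
  (forall x, minus (scal l (B x)) (A (B x)) = x).

Lemma resolvent_identity (A B1 B2 : V -> V) (l1 l2 : C) (x : V) :
  is_resolvent A l1 B1 -> is_resolvent A l2 B2 ->
  minus (B1 x) (B2 x) = scal (l2 - l1)%C (B1 (B2 x)).
Proof.
  intros [L1 [I1 _]] [_ [_ J2]].
  transitivity (B1 (minus x (minus (scal l1 (B2 x)) (A (B2 x))))).
  { rewrite (linear_minus _ _ _ L1). now rewrite I1. }
  rewrite <- (linear_scal _ L1). apply f_equal.
  rewrite <- (J2 x) at 1.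
  transitivity (minus (scal l2 (B2 x)) (scal l1 (B2 x))).
  - symmetry. etransitivity; [apply (minus_trans (A (B2 x)))|].
    unfold minus at 3. apply f_equal. symmetry. apply opp_minus.
  - symmetry. apply (scal_minus_distr_r (V := V) l2 l1).
Qed.

Lemma resolvent_commutes (A B : V -> V) (l : C) (x : V) :
  is_linear A -> is_resolvent A l B -> B (A x) = A (B x).
Proof.
  intros hA [LB [IB JB]].
  rewrite <- (IB (A (B x))). apply f_equal.
  rewrite <- (JB x) at 1.
  rewrite (linear_minus _ _ _ hA). now rewrite (linear_scal _ hA).
Qed.

Lemma resolvent_commutes_pow (A B : V -> V) (l : C) (n : nat) (x : V) :
  is_linear A -> is_resolvent A l B -> B (op_pow A n x) = op_pow A n (B x).
Proof.
  intros hA HB. induction n as [|n IH]; [reflexivity|].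
  simpl. change (Nat.iter n A ?y) with (op_pow A n y).
  now rewrite (resolvent_commutes A B l _ hA HB), IH.
Qed.


(** * The spectral radius *)

(** The operator norm of [A ^ N] is eventually at most [s ^ N]. *)
Definition decay (A : V -> V) (s : R) : Prop :=
  exists N0, forall N x, (N0 <= N)%nat -> norm (op_pow A N x) <= s ^ N * norm x.

Lemma circle_mean_resolvent (A : V -> V) (Rz : C -> V -> V) (r : R) (m n : nat) (x : V) :
  is_linear A -> (forall l, 1 < Cmod l -> is_resolvent A l (Rz l)) -> 1 < r ->
  (n <= m)%nat ->
  let y := circle_mean (fun l => scal (l ^ S n)%C (Rz l x)) r m in
  minus (scal (RtoC r ^ S m)%C y) (op_pow A (S m) y)
  = scal (RtoC r ^ S m)%C (op_pow A n x).
Proof.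
  intros hA HR Hr Hn. apply (discrete_cauchy A (fun l => Rz l x)); [assumption..|].
  intros k. apply HR. rewrite Cmod_circ; lra.
Qed.

Lemma Cmod_RtoC_pow (r : R) (n : nat) : 0 <= r -> Cmod (RtoC r ^ n) = r ^ n.
Proof. intros Hr. rewrite Cmod_pow, Cmod_R, Rabs_pos_eq; [reflexivity|exact Hr]. Qed.

Lemma minus_minus_r (x y : V) : minus x (minus x y) = y.
Proof.
  unfold minus. rewrite (opp_plus (G := V)), (opp_opp (G := V)), plus_assoc.
  now rewrite (plus_opp_r (G := V)), plus_zero_l.
Qed.

Lemma minus_swap (x y z w : V) : minus x y = minus z w -> minus y w = minus x z.
Proof.
  intros H. rewrite (minus_trans z y w), <- H, plus_comm.
  symmetry. apply minus_trans.
Qed.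

Lemma scal_resolvent_lipschitz (A : V -> V) (Rz : C -> V -> V) (a K : R) (l1 l2 : C) (x : V) :
  (forall z, norm (A z) <= a * norm z) ->
  is_resolvent A l1 (Rz l1) -> is_resolvent A l2 (Rz l2) ->
  0 <= a -> 0 <= K ->
  (forall z, norm (Rz l1 z) <= K * norm z) ->
  (forall z, norm (Rz l2 z) <= K * norm z) ->
  is_linear A ->
  norm (minus (scal l1 (Rz l1 x)) (scal l2 (Rz l2 x)))
  <= Cmod (l2 - l1) * (a * K ^ 2) * norm x.
Proof.
  intros Ha H1 H2 Ha0 HK K1 K2 hA.
  (* [l R(l) = 1 + A R(l)] *)
  replace (minus (scal l1 (Rz l1 x)) (scal l2 (Rz l2 x)))
    with (A (minus (Rz l1 x) (Rz l2 x))).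
  - rewrite (resolvent_identity A _ _ l1 l2 x H1 H2), (linear_scal _ hA), norm_scal_C.
    rewrite Rmult_assoc. apply Rmult_le_compat_l; [apply Cmod_ge_0|].
    eapply Rle_trans; [apply Ha|].
    replace (a * K ^ 2 * norm x) with (a * (K * (K * norm x))) by ring.
    apply Rmult_le_compat_l; [exact Ha0|].
    eapply Rle_trans; [apply K1|]. apply Rmult_le_compat_l; [exact HK|apply K2].
  - rewrite (linear_minus _ _ _ hA).
    destruct H1 as [_ [_ J1]]. destruct H2 as [_ [_ J2]].
    apply minus_swap. now rewrite J1, J2.
Qed.

(** One step towards the unit circle, from [s] through [mu > s] to [l <= mu].
    The average [Q mu] of [c R(c)] over the circle of radius [mu] is the inverse
    of [1 - (A / mu) ^ N], hence close to the identity for large [N], and [Q l] is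
    within [1 / 4] of [Q mu], as [a * K ^ 2] is a Lipschitz constant of [c R(c)]
    on [|c| >= l]. *)
Lemma decay_step (A : V -> V) (Rz : C -> V -> V) (a K l s : R) :
  is_linear A -> (forall l, 1 < Cmod l -> is_resolvent A l (Rz l)) ->
  0 <= a -> (forall z, norm (A z) <= a * norm z) ->
  0 <= K -> (forall c z, l <= Cmod c -> norm (Rz c z) <= K * norm z) ->
  1 < l -> 0 <= s -> forall mu, s < mu -> l <= mu -> (mu - l) * (a * K ^ 2) <= / 4 ->
  decay A s -> decay A l.
Proof.
  intros hA HR Ha0 Ha HK0 HK Hl Hs mu Hsmu Hlmu Hstep [N0 HN0].
  assert (Hq : is_lim_seq (fun n => (s / mu) ^ n) 0).
  { apply is_lim_seq_geom. rewrite Rabs_pos_eq.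
    - apply Rlt_div_l; lra.
    - apply Rdiv_le_0_compat; lra. }
  assert (H5 : 0 < / 5) by lra.
  apply is_lim_seq_spec in Hq. destruct (Hq (mkposreal _ H5)) as [N1 HN1]. simpl in HN1.
  exists (S (N0 + N1)). intros [|m] y HN; [lia|].
  set (N := S m) in *.
  set (Q := fun (r : R) (x : V) => circle_mean (fun c => scal (c ^ 1)%C (Rz c x)) r m).
  assert (HQ : forall r x, 1 < r ->
    minus (scal (RtoC r ^ N)%C (Q r x)) (op_pow A N (Q r x)) = scal (RtoC r ^ N)%C x).
  { intros r x Hr. apply (circle_mean_resolvent A Rz r m 0 x hA HR Hr). lia. }
  set (x := minus (scal (RtoC l ^ N)%C y) (op_pow A N y) : V).
  (* [Q l] is also a left inverse of [1 - (A / l) ^ N] *)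
  assert (Hx : Q l x = scal (RtoC l ^ N)%C y).
  { rewrite <- (HQ l y Hl).
    set (T := fun z : V => minus (scal (RtoC l ^ N)%C z) (op_pow A N z)).
    assert (hT : is_linear T) by (apply is_linear_shift, op_pow_linear, hA).
    change (Q l x = T (Q l y)). unfold Q. rewrite (linear_circle_mean _ _ _ _ hT).
    apply circle_mean_ext. intros k.
    assert (HRk : is_resolvent A (circ l N k) (Rz (circ l N k)))
      by (apply HR; rewrite Cmod_circ; lra).
    rewrite (linear_scal _ hT). apply f_equal. unfold T, x.
    assert (HL := proj1 HRk).
    rewrite (linear_minus _ _ _ HL), (linear_scal _ HL).
    now rewrite (resolvent_commutes_pow A _ _ N y hA HRk). }
  assert (HlN : 0 < l ^ N) by (apply pow_lt; lra).
  assert (HmN : 0 < mu ^ N) by (apply pow_lt; lra).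
  set (z := Q mu x).
  assert (Hz : norm (minus z x) <= / 4 * norm x).
  { assert (Hz1 : mu ^ N * norm (minus z x) <= s ^ N * norm z).
    { rewrite <- (Cmod_RtoC_pow mu N) by lra.
      rewrite <- norm_scal_C.
      replace (scal (RtoC mu ^ N)%C (minus z x)) with (op_pow A N z).
      - apply HN0. lia.
      - symmetry. rewrite (scal_minus_distr_l (V := V)).
        etransitivity; [|apply (minus_minus_r (scal (RtoC mu ^ N)%C z))].
        apply (f_equal (fun t : V => minus (scal (RtoC mu ^ N)%C z) t)).
        symmetry. apply HQ. lra. }
    assert (Hz2 : s ^ N <= / 5 * mu ^ N).
    { specialize (HN1 N). unfold Rdiv in HN1.
      rewrite Rminus_0_r, Rpow_mult_distr, pow_inv in HN1.
      change (s ^ N * / mu ^ N) with (s ^ N / mu ^ N) in HN1.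
      assert (HH := HN1 ltac:(lia)). apply Rabs_def2 in HH. destruct HH as [HH _].
      apply Rlt_div_l in HH; lra. }
    assert (Hz3 : norm z <= norm x + norm (minus z x)).
    { replace z with (plus x (minus z x)) at 1; [apply (norm_triangle (V := V))|].
      unfold minus. rewrite (plus_comm z), plus_assoc, (plus_opp_r (G := V)).
      apply plus_zero_l. }
    assert (H0 := norm_ge_0 z).
    assert (mu ^ N * norm (minus z x) <= mu ^ N * (/ 5 * norm z)) by nra.
    apply Rmult_le_reg_l in H; [lra|exact HmN]. }
  assert (Hlz : norm (minus (Q l x) z) <= / 4 * norm x).
  { apply norm_circle_mean_minus_le. intros k. fold N.
    eapply Rle_trans.
    - rewrite !Cpow_1_r. apply (scal_resolvent_lipschitz A Rz a K); try assumption.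
      + apply HR. rewrite Cmod_circ; lra.
      + apply HR. rewrite Cmod_circ; lra.
      + intros w. apply HK. rewrite Cmod_circ; lra.
      + intros w. apply HK. rewrite Cmod_circ; lra.
    - apply Rmult_le_compat_r; [apply norm_ge_0|].
      replace (circ mu N k - circ l N k)%C with (circ (mu - l) N k)
        by (unfold circ; rewrite RtoC_minus; ring).
      rewrite Cmod_circ; lra. }
  assert (Hy : norm (op_pow A N y) <= / 2 * norm x).
  { replace (op_pow A N y) with (plus (minus (Q l x) z) (minus z x)).
    - eapply Rle_trans; [apply (norm_triangle (V := V))|]. lra.
    - rewrite <- (minus_trans z (Q l x) x), Hx. apply minus_minus_r. }
  assert (Hx2 : norm x <= l ^ N * norm y + norm (op_pow A N y)).
  { eapply Rle_trans; [apply norm_minus_le|].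
    rewrite norm_scal_C, Cmod_RtoC_pow; lra. }
  lra.
Qed.

(** A bound [P / (|l| - 1)] on the resolvent outside the unit disk forces the
    spectral radius to be at most [1]. *)
Lemma decay_outside_disk (A : V -> V) (Rz : C -> V -> V) (P r : R) :
  is_linear A -> (forall l, 1 < Cmod l -> is_resolvent A l (Rz l)) ->
  0 <= P -> (forall l x, 1 < Cmod l -> (Cmod l - 1) * norm (Rz l x) <= P * norm x) ->
  1 < r -> decay A r.
Proof.
  intros hA HR HP0 HP Hr.
  destruct (linear_norm A hA) as [a [Ha0 Ha]].
  set (K := P / (r - 1)).
  assert (HK0 : 0 <= K) by (apply Rdiv_le_0_compat; lra).
  assert (HK : forall c z, r <= Cmod c -> norm (Rz c z) <= K * norm z).
  { intros c z Hc. assert (H := HP c z ltac:(lra)).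
    unfold K. apply Rmult_le_reg_l with (r - 1); [lra|].
    replace ((r - 1) * (P / (r - 1) * norm z)) with (P * norm z) by (field; lra).
    assert (H0 := norm_ge_0 (Rz c z)). nra. }
  set (B := a * K ^ 2).
  assert (HB : 0 <= B) by (apply Rmult_le_pos; [lra|apply pow2_ge_0]).
  (* with [mu = s + d] and [s - d <= l <= s], the distance [mu - l] is at most
     [2 d] *)
  set (d := / (8 * (B + 1))).
  assert (Hd : 0 < d) by (apply Rinv_0_lt_compat; lra).
  assert (HdB : 2 * d * B <= / 4).
  { assert (d * (B + 1) = / 8) by (unfold d; field; lra). lra. }
  set (s0 := Rmax a r).
  assert (Hs0 : forall i : nat, decay A (Rmax r (s0 - INR i * d))).
  { induction i as [|i IH].
    - exists 0%nat. intros N x _.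
      assert (Hs : a <= Rmax r (s0 - INR 0 * d)).
      { simpl. rewrite Rmult_0_l, Rminus_0_r. unfold s0.
        eapply Rle_trans; [apply Rmax_l|apply Rmax_r]. }
      revert Hs. generalize (Rmax_l r (s0 - INR 0 * d)).
      generalize (Rmax r (s0 - INR 0 * d)). intros t Hrt Hs.
      induction N as [|N IHN]; [simpl; lra|].
      simpl. eapply Rle_trans; [apply Ha|].
      apply Rle_trans with (t * norm (op_pow A N x)).
      + apply Rmult_le_compat_r; [apply norm_ge_0|exact Hs].
      + rewrite Rmult_assoc. apply Rmult_le_compat_l; [lra|exact IHN].
    - set (s := Rmax r (s0 - INR i * d)) in *.
      set (l := Rmax r (s0 - INR (S i) * d)).
      assert (r <= s) by apply Rmax_l. assert (r <= l) by apply Rmax_l.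
      assert (l <= s /\ s <= l + d).
      { unfold l, s. rewrite S_INR. unfold Rmax.
        destruct (Rle_dec r (s0 - (INR i + 1) * d)), (Rle_dec r (s0 - INR i * d)); nra. }
      apply (decay_step A Rz a K l s hA HR ltac:(lra) Ha HK0) with (mu := s + d);
        try assumption; try lra.
      + intros c z Hc. apply HK. lra.
      + fold B. nra. }
  destruct (nfloor_ex ((s0 - r) / d)) as [i [_ Hi]].
  { apply Rdiv_le_0_compat; [|exact Hd]. generalize (Rmax_r a r). unfold s0. lra. }
  replace r with (Rmax r (s0 - INR (S i) * d)); [apply Hs0|].
  apply Rmax_left. rewrite S_INR. apply Rlt_div_l in Hi; lra.
Qed.


(** * Finite sums *)

Lemma summation_by_parts (w : C) (v : nat -> V) (m : nat) :
  (w ^ S m)%C = 1%C -> v (S m) = v 0%nat ->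
  sum_n (fun k => scal (w ^ S k)%C (minus (v k) (v (S k)))) m
  = scal (w - 1)%C (sum_n (fun k => scal (w ^ k)%C (v k)) m).
Proof.
  intros Hw Hv.
  set (T := fun k => scal (w ^ k)%C (v k) : V).
  rewrite (sum_n_ext _ (fun k => plus (scal (w - 1)%C (T k)) (minus (T k) (T (S k))))).
  2:{ intros k. rewrite (scal_minus_distr_l (V := V)).
      etransitivity; [apply (minus_trans (T k))|].
      apply (f_equal (fun t : V => plus t (minus (T k) (T (S k))))).
      unfold T. rewrite scal_assoc.
      symmetry. etransitivity; [|apply (scal_minus_distr_r (V := V))].
      apply (f_equal (fun c : C => scal c (v k))).
      change ((w - 1) * w ^ k = w ^ S k - w ^ k)%C. rewrite Cpow_S. ring. }
  rewrite (sum_n_plus (G := V)), (sum_n_scal_l (V := V)).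
  assert (Htel : forall p, sum_n (fun k => minus (T k) (T (S k))) p = minus (T 0%nat) (T (S p))).
  { induction p as [|p IH]; [now rewrite sum_O|].
    rewrite sum_Sn, IH. symmetry. apply minus_trans. }
  rewrite Htel. replace (T (S m)) with (T 0%nat).
  - rewrite (minus_eq_zero (G := V)). apply plus_zero_r.
  - unfold T. rewrite Hw, Hv. reflexivity.
Qed.

End Averages.

Lemma sum_n_period (g : nat -> R) (m : nat) :
  g (S m) = g 0%nat -> sum_n (fun k => g (S k)) m = sum_n g m.
Proof.
  intros Hg.
  assert (H : forall p, sum_n (fun k => g (S k)) p + g 0%nat = sum_n g p + g (S p)).
  { induction p as [|p IH]; [rewrite !sum_O; ring|].
    rewrite !sum_Sn. change (@plus R_AbelianMonoid) with Rplus. lra. }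
  specialize (H m). rewrite Hg in H.
  apply Rplus_eq_reg_r with (g 0%nat). exact H.
Qed.

Lemma sum_n_affine (p q : R) (u : nat -> R) (m : nat) :
  sum_n (fun k => p * u k + q) m = p * sum_n u m + INR (S m) * q.
Proof.
  induction m as [|m IH].
  - rewrite !sum_O. simpl. ring.
  - rewrite !sum_Sn, IH, (S_INR (S m)). change (@plus R_AbelianMonoid) with Rplus.
    match goal with |- ?a = ?b => change (@eq R a b) end. ring.
Qed.

Lemma sum_n_R_le (u v : nat -> R) (m : nat) :
  (forall k, u k <= v k) -> sum_n u m <= sum_n v m.
Proof. intros H. apply (sum_n_m_le u v). exact H. Qed.

(** * The Poisson kernel on equally spaced points *)

(** For [|z| = 1], twice the real part of [l / (l - z)], minus [1], is the
    Poisson kernel. *)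
Lemma Re_kernel (l : C) (z : R) :
  z ^ 2 = 1 -> 1 < Cmod l ->
  (Cmod l ^ 2 - 1) * / Cmod (l - RtoC z) ^ 2 = 2 * Re (l * / (l - RtoC z))%C - 1.
Proof.
  intros Hz Hl.
  assert (Hd : 0 < Cmod (l - RtoC z) ^ 2).
  { apply pow_lt, Cmod_gt_0. intros H.
    assert (Hlz : l = RtoC z) by (replace l with ((l - RtoC z) + RtoC z)%C by ring; rewrite H; ring).
    rewrite Hlz, Cmod_R in Hl.
    assert (Rabs z ^ 2 = 1) by (rewrite pow2_abs; exact Hz). nra. }
  rewrite Cmod2_alt in *. revert Hd. rewrite Cmod2_alt. destruct l as [a b].
  unfold Re, Im. simpl. intros Hd.
  field_simplify_eq.
  - simpl in Hz. nra.
  - nra.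
Qed.

Lemma Re_sum_n (u : nat -> C) (m : nat) :
  Re (@sum_n C_Ring u m) = sum_n (fun k => Re (u k)) m.
Proof.
  induction m as [|m IH]; [now rewrite !sum_O|].
  rewrite !sum_Sn, <- IH. reflexivity.
Qed.

Lemma Re_circle_mean (f : C -> C) (r : R) (m : nat) :
  Re (circle_mean (V := C_NormedModule) f r m)
  = / INR (S m) * sum_n (fun k => Re (f (circ r (S m) k))) m.
Proof.
  rewrite <- Re_sum_n. unfold circle_mean.
  generalize (/ INR (S m)). intros c.
  assert (H : forall z : C, Re (RtoC c * z)%C = c * Re z)
    by (intros [p q]; unfold Re; simpl; ring).
  apply H.
Qed.

(** Up to an aliasing factor, the average of [1 / |l - z| ^ 2] is at most its
    mean [1 / (r ^ 2 - 1)] over the whole circle. *)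
Lemma poisson_sum (z r : R) (m : nat) :
  z ^ 2 = 1 -> 1 < r ->
  sum_n (fun k => / Cmod (circ r (S m) k - RtoC z) ^ 2) m
  <= INR (S m) * / (r ^ 2 - 1) * ((r ^ S m + 1) / (r ^ S m - 1)).
Proof.
  intros Hz Hr.
  set (N := S m).
  assert (HN : 0 < INR N) by (apply lt_0_INR; unfold N; lia).
  assert (HrN : 1 < r ^ N) by (apply Rlt_pow_R1; [exact Hr|unfold N; lia]).
  set (Az := fun w : C_NormedModule => scal (RtoC z) w).
  assert (hA : is_linear Az) by (apply (is_linear_scal_r (V := C_NormedModule)); exact Cmult_comm).
  assert (Hne : forall k, (circ r N k - RtoC z)%C <> 0%C).
  { intros k H.
    assert (Hk : circ r N k = RtoC z)
      by (replace (circ r N k) with ((circ r N k - RtoC z) + RtoC z)%C by ring; rewrite H; ring).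
    assert (Hm := Cmod_circ r N k). rewrite Hk, Cmod_R in Hm.
    assert (Rabs z ^ 2 = 1) by (rewrite pow2_abs; exact Hz).
    assert (Rabs z = r) by (apply Hm; lra). nra. }
  (* the discrete Cauchy formula for multiplication by [z] on the complex line *)
  assert (Hc := discrete_cauchy (V := C_NormedModule) Az (fun l => (/ (l - RtoC z))%C)
                 (RtoC 1) r m 0 hA (Nat.le_0_l m)).
  fold N in Hc.
  set (y := circle_mean (V := C_NormedModule)
              (fun l => scal (l ^ 1)%C (/ (l - RtoC z))%C) r m : C) in Hc.
  assert (Hpow : forall p (w : C), op_pow Az p w = (RtoC (z ^ p) * w)%C).
  { intros p w. induction p as [|p IH].
    - simpl. ring.
    - change (op_pow Az (S p) w) with (RtoC z * op_pow Az p w)%C.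
      rewrite IH. simpl. rewrite RtoC_mult. ring. }
  assert (Hy : (RtoC (r ^ N - z ^ N) * y)%C = RtoC (r ^ N)).
  { rewrite RtoC_minus, RtoC_pow.
    transitivity (RtoC r ^ N * y - op_pow Az N y)%C; [rewrite Hpow; ring|].
    transitivity (RtoC r ^ N * RtoC 1)%C; [|ring].
    apply Hc. intros k.
    change (circ r N k * / (circ r N k - RtoC z) - RtoC z * / (circ r N k - RtoC z) = 1)%C.
    field. apply Hne. }
  assert (HRe : (r ^ N - z ^ N) * Re y = r ^ N).
  { revert Hy. generalize (r ^ N - z ^ N) (r ^ N) y. intros p q [u t] Hy.
    unfold RtoC, Cmult in Hy. simpl in Hy. injection Hy as Hy _.
    unfold Re. simpl. lra. }
  assert (Hmean : INR N * Re y
    = sum_n (fun k => Re (circ r N k * / (circ r N k - RtoC z))%C) m).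
  { unfold y. rewrite Re_circle_mean. fold N.
    rewrite <- Rmult_assoc, Rinv_r, Rmult_1_l by lra.
    apply sum_n_ext. intros k. now rewrite Cpow_1_r. }
  assert (HzN : z ^ N = 1 \/ z ^ N = -1).
  { assert (HzN : (z ^ N) ^ 2 = 1)
      by (rewrite <- pow_mult, Nat.mul_comm, pow_mult, Hz; apply pow1). nra. }
  assert (HK : (r ^ 2 - 1) * sum_n (fun k => / Cmod (circ r N k - RtoC z) ^ 2) m
    = INR N * (2 * Re y - 1)).
  { transitivity (2 * (INR N * Re y) + INR N * - 1); [|ring].
    rewrite Hmean. unfold N at 3. rewrite <- sum_n_affine.
    rewrite <- (sum_n_mult_l (K := R_Ring)). apply sum_n_ext. intros k.
    assert (Hk := Re_kernel (circ r N k) z Hz).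
    rewrite Cmod_circ in Hk by lra. apply Hk. exact Hr. }
  apply Rmult_le_reg_l with (r ^ 2 - 1); [nra|].
  rewrite HK.
  replace ((r ^ 2 - 1) * (INR N * / (r ^ 2 - 1) * ((r ^ N + 1) / (r ^ N - 1))))
    with (INR N * ((r ^ N + 1) / (r ^ N - 1))) by (field; split; nra).
  apply Rmult_le_compat_l; [lra|].
  replace (Re y) with (r ^ N / (r ^ N - z ^ N)) by (rewrite <- HRe at 1; field; lra).
  destruct HzN as [-> | ->].
  - apply Req_le. field. lra.
  - replace (2 * (r ^ N / (r ^ N - -1)) - 1) with ((r ^ N - 1) / (r ^ N + 1))
      by (field; lra).
    apply Rle_trans with 1.
    + apply Rle_div_l; lra.
    + apply Rle_div_r; lra.
Qed.

(** * The estimate for a fixed radius *)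

(** Distance to the pair [{-1, 1}]. *)
Definition dist_pm1 (l : C) : R :=
  Rmin (Cmod (l - RtoC 1)) (Cmod (l - RtoC (-1))).

Lemma dist_pm1_ge (l : C) : Cmod l - 1 <= dist_pm1 l.
Proof.
  assert (H : forall t, Rabs t = 1 -> Cmod l - 1 <= Cmod (l - RtoC t)).
  { intros t Ht. assert (H := Cmod_triangle (l - RtoC t) (RtoC t)).
    rewrite Cmod_R, Ht in H. replace (l - t + t)%C with l in H by ring. lra. }
  apply Rmin_glb; apply H; [apply Rabs_R1|].
  rewrite Rabs_left; lra.
Qed.

Lemma inv_dist_pm1_le (l : C) :
  1 < Cmod l ->
  / dist_pm1 l ^ 2 <= / Cmod (l - RtoC 1) ^ 2 + / Cmod (l - RtoC (-1)) ^ 2.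
Proof.
  intros Hl. assert (Hd := dist_pm1_ge l).
  assert (H1 := Rmin_l (Cmod (l - RtoC 1)) (Cmod (l - RtoC (-1)))).
  assert (H2 := Rmin_r (Cmod (l - RtoC 1)) (Cmod (l - RtoC (-1)))).
  fold (dist_pm1 l) in H1, H2.
  assert (0 < / Cmod (l - RtoC 1) ^ 2) by (apply Rinv_0_lt_compat, pow_lt; lra).
  assert (0 < / Cmod (l - RtoC (-1)) ^ 2) by (apply Rinv_0_lt_compat, pow_lt; lra).
  unfold dist_pm1 at 1, Rmin.
  destruct (Rle_dec _ _); lra.
Qed.

Lemma sum_inv_dist_pm1_le (r : R) (m : nat) :
  1 < r ->
  sum_n (fun k => / dist_pm1 (circ r (S m) k) ^ 2) m
  <= INR (S m) * (2 / (r ^ 2 - 1) * ((r ^ S m + 1) / (r ^ S m - 1))).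
Proof.
  intros Hr.
  eapply Rle_trans; [apply sum_n_R_le with (v := fun k =>
    plus (/ Cmod (circ r (S m) k - RtoC 1) ^ 2) (/ Cmod (circ r (S m) k - RtoC (-1)) ^ 2))|].
  - intros k. apply inv_dist_pm1_le. rewrite Cmod_circ; lra.
  - rewrite (sum_n_plus (G := R_AbelianMonoid)).
    assert (H1 := poisson_sum 1 r m ltac:(ring) Hr).
    assert (H2 := poisson_sum (-1) r m ltac:(ring) Hr).
    eapply Rle_trans; [apply Rplus_le_compat; [exact H1|exact H2]|].
    apply Req_le. unfold Rdiv. ring.
Qed.

Lemma sum_cos_le_Cmod (N n : nat) :
  sum_n (fun j => cos (INR j * (2 * PI / INR N))) n
  <= Cmod (@sum_n C_Ring (fun j => omega N ^ j)%C n).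
Proof.
  eapply Rle_trans; [|apply re_le_Cmod].
  eapply Rle_trans; [|apply Rle_abs].
  rewrite Re_sum_n. apply Req_le. apply sum_n_ext.
  intros j. now rewrite omega_pow.
Qed.

Section Estimate.

Context {V : NormedModule C_AbsRing}.

(** Bound on the average of the discrete Cauchy formula, by summation by parts.
    The sum of cosines stands for the factor [n + 1]: it is the real part of
    [(w ^ (n + 1) - 1) / (w - 1)], where [w = exp (2 i PI / N)]. *)
Lemma norm_circle_mean_le (A : V -> V) (Rz : C -> V -> V) (P r : R) (m n : nat) (x : V) :
  (forall l, 1 < Cmod l -> is_resolvent A l (Rz l)) ->
  0 <= P ->
  (forall l z, 1 < Cmod l -> dist_pm1 l * norm (Rz l z) <= P * norm z) ->
  1 < r -> (0 < m)%nat ->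
  sum_n (fun j => cos (INR j * (2 * PI / INR (S m)))) n
    * norm (circle_mean (fun l => scal (l ^ S n)%C (Rz l x)) r m)
  <= 2 * r ^ (n + 2) / (r ^ 2 - 1) * ((r ^ S m + 1) / (r ^ S m - 1)) * P ^ 2 * norm x.
Proof.
  intros HR HP0 HP Hr Hm.
  set (N := S m).
  assert (HN : 0 < INR N) by (apply lt_0_INR; unfold N; lia).
  set (l := circ r N). set (v := fun k => Rz (l k) x).
  set (w := (omega N ^ S n)%C). set (g := fun k => / dist_pm1 (l k) ^ 2).
  assert (Hl : forall k, Cmod (l k) = r) by (intros k; apply Cmod_circ; lra).
  assert (Hd : forall k, 0 < dist_pm1 (l k))
    by (intros k; assert (Hk := dist_pm1_ge (l k)); rewrite Hl in Hk; lra).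
  assert (HRk : forall k, is_resolvent A (l k) (Rz (l k)))
    by (intros k; apply HR; rewrite Hl; exact Hr).
  assert (Hper : l N = l 0%nat) by apply circ_period.
  set (T := sum_n (fun k => scal (w ^ k)%C (v k)) m : V).
  (* the average is a multiple of [T] *)
  assert (Hmean : circle_mean (fun c => scal (c ^ S n)%C (Rz c x)) r m
                  = scal (RtoC (r ^ S n / INR N)) T).
  { unfold circle_mean, T. fold N.
    rewrite <- !(sum_n_scal_l (V := V)). apply sum_n_ext. intros k.
    rewrite !scal_assoc. apply (f_equal (fun c : C => scal c (v k))).
    change (RtoC (/ INR N) * l k ^ S n = RtoC (r ^ S n / INR N) * w ^ k)%C.
    unfold l, circ, w, Rdiv.
    rewrite Cpow_mult_l, <- !Cpow_mult_r, (Nat.mul_comm k), RtoC_mult, RtoC_pow.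
    ring. }
  (* differences of neighbouring resolvents *)
  assert (Hdiff : forall k, norm (minus (v k) (v (S k)))
                  <= r * Cmod (omega N - 1) * P ^ 2 * norm x * ((g k + g (S k)) / 2)).
  { intros k. unfold v.
    rewrite (resolvent_identity A _ _ (l k) (l (S k)) x (HRk k) (HRk (S k))).
    rewrite norm_scal_C.
    replace (l (S k) - l k)%C with (l k * (omega N - 1))%C
      by (unfold l, circ; rewrite Cpow_S; ring).
    rewrite Cmod_mult, Hl.
    assert (Hn1 : norm (Rz (l k) (Rz (l (S k)) x))
              <= P ^ 2 * norm x * (/ dist_pm1 (l k) * / dist_pm1 (l (S k)))).
    { apply Rmult_le_reg_l with (dist_pm1 (l k)); [apply Hd|].
      eapply Rle_trans; [apply HP; rewrite Hl; exact Hr|].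
      apply Rmult_le_reg_l with (dist_pm1 (l (S k))); [apply Hd|].
      replace (dist_pm1 (l (S k)) * (dist_pm1 (l k) *
        (P ^ 2 * norm x * (/ dist_pm1 (l k) * / dist_pm1 (l (S k))))))
        with (P * (P * norm x))
        by (field; split; apply Rgt_not_eq, Hd).
      rewrite <- Rmult_assoc, (Rmult_comm _ P), Rmult_assoc.
      apply Rmult_le_compat_l; [exact HP0|]. apply HP. rewrite Hl; exact Hr. }
    assert (HAG : / dist_pm1 (l k) * / dist_pm1 (l (S k)) <= (g k + g (S k)) / 2).
    { unfold g. rewrite <- !pow_inv.
      generalize (pow2_ge_0 (/ dist_pm1 (l k) - / dist_pm1 (l (S k)))). nra. }
    rewrite (Rmult_assoc (r * _ * _)), (Rmult_assoc (r * _)).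
    apply Rmult_le_compat_l.
    - apply Rmult_le_pos; [lra|apply Cmod_ge_0].
    - eapply Rle_trans; [exact Hn1|]. rewrite Rmult_assoc.
      apply Rmult_le_compat_l; [apply pow2_ge_0|].
      apply Rmult_le_compat_l; [apply norm_ge_0|exact HAG]. }
  assert (HT : Cmod (w - 1) * norm T
               <= r * Cmod (omega N - 1) * P ^ 2 * norm x * sum_n g m).
  { rewrite <- norm_scal_C. unfold T.
    rewrite <- summation_by_parts.
    - eapply Rle_trans; [apply norm_sum_n_le with (b := fun k =>
        mult (r * Cmod (omega N - 1) * P ^ 2 * norm x) ((g k + g (S k)) / 2))|].
      + intros k _. rewrite norm_scal_C, Cmod_pow. unfold w.
        rewrite Cmod_omega_pow, pow1, Rmult_1_l. apply Hdiff.
      + rewrite (sum_n_mult_l (K := R_Ring)). apply Req_le.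
        apply (f_equal (Rmult _)).
        rewrite (sum_n_ext (G := R_AbelianMonoid) _
          (fun k => mult (/ 2) (plus (g k) (g (S k))))).
        * rewrite (sum_n_mult_l (K := R_Ring)), (sum_n_plus (G := R_AbelianMonoid)).
          rewrite sum_n_period.
          -- change (/ 2 * (sum_n g m + sum_n g m) = sum_n g m). field.
          -- unfold g. fold N. now rewrite Hper.
        * intros k. change ((g k + g (S k)) / 2 = / 2 * (g k + g (S k))). field.
    - unfold w. rewrite <- Cpow_mult_r, Nat.mul_comm, Cpow_mult_r.
      unfold N. rewrite omega_pow_order. apply Cpow_1_l.
    - unfold v. fold N. now rewrite Hper. }
  assert (Hom : 0 < Cmod (omega N - 1)).
  { apply Cmod_gt_0. intros H. apply (omega_pow_neq_1 m 1); [lia|].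
    rewrite Cpow_1_r. fold N.
    replace (omega N) with ((omega N - 1) + 1)%C by ring. rewrite H. ring. }
  set (q := @sum_n C_Ring (fun j => omega N ^ j)%C n : C).
  assert (Hw : Cmod (w - 1) = Cmod (omega N - 1) * Cmod q).
  { unfold w, q. rewrite <- Cmod_mult. f_equal. symmetry. apply sum_geom_C. }
  assert (HqT : Cmod q * norm T <= r * P ^ 2 * norm x * sum_n g m).
  { apply Rmult_le_reg_l with (Cmod (omega N - 1)); [exact Hom|].
    rewrite <- Rmult_assoc, <- Hw. eapply Rle_trans; [exact HT|].
    apply Req_le. ring. }
  assert (Hg : sum_n g m <= INR N * (2 / (r ^ 2 - 1) * ((r ^ N + 1) / (r ^ N - 1))))
    by (now apply sum_inv_dist_pm1_le).
  rewrite Hmean, norm_scal_C, Cmod_R.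
  assert (HrN0 : 0 < r ^ S n / INR N) by (apply Rdiv_lt_0_compat; [apply pow_lt; lra|exact HN]).
  rewrite Rabs_pos_eq by lra.
  apply Rle_trans with (Cmod q * (r ^ S n / INR N * norm T)).
  { apply Rmult_le_compat_r.
    - apply Rmult_le_pos; [lra|apply norm_ge_0].
    - apply sum_cos_le_Cmod. }
  apply Rle_trans with (r ^ S n / INR N * (r * P ^ 2 * norm x * sum_n g m)).
  { replace (Cmod q * (r ^ S n / INR N * norm T))
      with (r ^ S n / INR N * (Cmod q * norm T)) by ring.
    apply Rmult_le_compat_l; [lra|exact HqT]. }
  apply Rle_trans with (r ^ S n / INR N * (r * P ^ 2 * norm x *
    (INR N * (2 / (r ^ 2 - 1) * ((r ^ N + 1) / (r ^ N - 1)))))).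
  { apply Rmult_le_compat_l; [lra|]. apply Rmult_le_compat_l; [|exact Hg].
    apply Rmult_le_pos; [|apply norm_ge_0].
    apply Rmult_le_pos; [lra|apply pow2_ge_0]. }
  assert (1 < r ^ N) by (apply Rlt_pow_R1; [exact Hr|unfold N; lia]).
  apply Req_le. replace (n + 2)%nat with (S (S n)) by lia.
  rewrite <- !tech_pow_Rmult. field. repeat split; nra.
Qed.

Lemma is_lim_seq_sum_cos (n : nat) :
  is_lim_seq (fun m => sum_n (fun j => cos (INR j * (2 * PI / INR (S m)))) n) (INR (S n)).
Proof.
  assert (H : forall j, is_lim_seq (fun m => cos (INR j * (2 * PI / INR (S m)))) 1).
  { intros j. rewrite <- cos_0.
    apply (is_lim_seq_continuous cos); [apply continuity_cos|].
    replace 0 with ((INR j * (2 * PI)) * 0) by ring.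
    apply is_lim_seq_ext with (fun m => (INR j * (2 * PI)) * / INR (S m)).
    { intros m. unfold Rdiv. ring. }
    apply (is_lim_seq_scal_l _ _ 0).
    apply is_lim_seq_incr_1 with (u := fun m => / INR m).
    replace (Finite 0) with (Rbar_inv p_infty) by reflexivity.
    apply is_lim_seq_inv; [apply is_lim_seq_INR|discriminate]. }
  induction n as [|n IH].
  - simpl INR. eapply is_lim_seq_ext; [|apply (H 0%nat)].
    intros m. cbv beta. now rewrite sum_O.
  - rewrite S_INR. eapply is_lim_seq_ext; [|apply is_lim_seq_plus'; [exact IH|apply (H (S n))]].
    intros m. cbv beta. now rewrite sum_Sn.
Qed.

Lemma norm_pow_le_radius (A : V -> V) (Rz : C -> V -> V) (P r : R) (n : nat) (x : V) :
  is_linear A ->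
  (forall l, 1 < Cmod l -> is_resolvent A l (Rz l)) ->
  0 <= P ->
  (forall l z, 1 < Cmod l -> dist_pm1 l * norm (Rz l z) <= P * norm z) ->
  1 < r ->
  INR (S n) * norm (op_pow A n x) <= 2 * r ^ (n + 2) / (r ^ 2 - 1) * P ^ 2 * norm x.
Proof.
  intros hA HR HP0 HP Hr.
  set (s := (1 + r) / 2).
  assert (Hs : 1 < s < r) by (unfold s; lra).
  destruct (decay_outside_disk A Rz P s hA HR HP0) as [N0 HN0].
  { intros l z Hl. eapply Rle_trans; [|apply HP; exact Hl].
    apply Rmult_le_compat_r; [apply norm_ge_0|apply dist_pm1_ge]. }
  { lra. }
  set (c := 2 * r ^ (n + 2) / (r ^ 2 - 1)).
  set (a := fun m => sum_n (fun j => cos (INR j * (2 * PI / INR (S m)))) n).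
  assert (Hlt : forall t, 0 <= t < 1 -> is_lim_seq (fun m => t ^ S m) 0).
  { intros t Ht. apply (is_lim_seq_incr_1 (fun m => t ^ m)).
    apply is_lim_seq_geom. rewrite Rabs_pos_eq; lra. }
  assert (Hsr : 0 <= s / r < 1).
  { split; [apply Rdiv_le_0_compat; lra|apply Rlt_div_l; lra]. }
  assert (Hir : 0 <= / r < 1).
  { split; [apply Rlt_le, Rinv_0_lt_compat; lra|].
    rewrite <- Rinv_1. apply Rinv_lt_contravar; lra. }
  set (b := fun m => (1 + (s / r) ^ S m) *
    ((1 + (/ r) ^ S m) / (1 - (/ r) ^ S m) * (c * P ^ 2 * norm x))).
  assert (Hb : is_lim_seq b (c * P ^ 2 * norm x)).
  { replace (c * P ^ 2 * norm x) with ((1 + 0) * ((1 + 0) / (1 - 0) * (c * P ^ 2 * norm x)))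
      by field.
    apply is_lim_seq_mult'.
    - apply is_lim_seq_plus'; [apply is_lim_seq_const|now apply Hlt].
    - apply is_lim_seq_mult'; [|apply is_lim_seq_const].
      apply is_lim_seq_div'; [| |lra].
      + apply is_lim_seq_plus'; [apply is_lim_seq_const|now apply Hlt].
      + apply is_lim_seq_minus'; [apply is_lim_seq_const|now apply Hlt]. }
  assert (Ha : is_lim_seq (fun m => a m * norm (op_pow A n x))
                 (INR (S n) * norm (op_pow A n x))).
  { apply is_lim_seq_mult'; [apply is_lim_seq_sum_cos|apply is_lim_seq_const]. }
  assert (Hapos : eventually (fun m => 0 < a m)).
  { assert (Hl := is_lim_seq_sum_cos n). apply is_lim_seq_spec in Hl.
    assert (Hn : 0 < INR (S n)) by (apply lt_0_INR; lia).
    destruct (Hl (mkposreal _ Hn)) as [N1 HN1]. exists N1. intros m Hm.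
    specialize (HN1 m Hm). change (pos (mkposreal _ Hn)) with (INR (S n)) in HN1.
    apply Rabs_def2 in HN1.
    unfold a. lra. }
  change (Rbar_le (INR (S n) * norm (op_pow A n x)) (c * P ^ 2 * norm x)).
  apply (is_lim_seq_le_loc (fun m => a m * norm (op_pow A n x)) b); [|exact Ha|exact Hb].
  destruct Hapos as [N1 HN1]. exists (S (n + N0 + N1)). intros m Hm.
  set (N := S m).
  set (y := circle_mean (fun l => scal (l ^ S n)%C (Rz l x)) r m).
  assert (Hy : minus (scal (RtoC r ^ N)%C y) (op_pow A N y)
               = scal (RtoC r ^ N)%C (op_pow A n x))
    by (apply (circle_mean_resolvent A Rz r m n x hA HR Hr); lia).
  assert (HrN : 1 < r ^ N) by (apply Rlt_pow_R1; [exact Hr|unfold N; lia]).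
  assert (H1 : norm (op_pow A n x) <= (1 + (s / r) ^ N) * norm y).
  { apply Rmult_le_reg_l with (r ^ N); [lra|].
    rewrite <- (Cmod_RtoC_pow r N) at 1 by lra. rewrite <- norm_scal_C, <- Hy.
    eapply Rle_trans; [apply norm_minus_le|].
    rewrite norm_scal_C, Cmod_RtoC_pow by lra.
    assert (HN := HN0 N y ltac:(unfold N; lia)).
    replace (r ^ N * ((1 + (s / r) ^ N) * norm y)) with (r ^ N * norm y + s ^ N * norm y).
    - lra.
    - unfold Rdiv. rewrite Rpow_mult_distr, pow_inv. field. lra. }
  assert (H2 := norm_circle_mean_le A Rz P r m n x HR HP0 HP Hr ltac:(lia)).
  fold y N c in H2.
  assert (Ham : 0 < a m) by (apply HN1; lia).
  apply Rle_trans with ((1 + (s / r) ^ N) * (a m * norm y)).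
  { replace ((1 + (s / r) ^ N) * (a m * norm y))
      with (a m * ((1 + (s / r) ^ N) * norm y)) by ring.
    apply Rmult_le_compat_l; lra. }
  unfold b. fold N. apply Rmult_le_compat_l.
  - assert (0 <= (s / r) ^ N) by (apply pow_le; lra). lra.
  - eapply Rle_trans; [exact H2|]. apply Req_le.
    rewrite pow_inv. field. lra.
Qed.

End Estimate.

(** * Euler's constant *)

(** The left-hand side minus the right-hand side vanishes at [0] and has
    derivative [ln (1 - t ^ 2)]. *)
Lemma ln_entropy_le (t : R) :
  0 <= t < 1 -> (1 + t) * ln (1 + t) - (1 - t) * ln (1 - t) <= 2 * t.
Proof.
  intros Ht.
  set (f := fun u => (1 + u) * ln (1 + u) - (1 - u) * ln (1 - u) - 2 * u).
  assert (Hf : forall u, 0 <= u <= t -> is_derive f u (ln (1 + u) + ln (1 - u))).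
  { intros u Hu. unfold f. auto_derive; [split; lra|].
    change (1 + - u) with (1 - u). field. split; lra. }
  destruct (MVT_gen f 0 t (fun u => ln (1 + u) + ln (1 - u))) as [u [Hu Heq]].
  - rewrite Rmin_left, Rmax_right by lra. intros u Hu. apply Hf. lra.
  - rewrite Rmin_left, Rmax_right by lra. intros u Hu.
    apply continuity_pt_filterlim. apply (ex_derive_continuous (V := R_NormedModule)).
    eexists. apply Hf. exact Hu.
  - rewrite Rmin_left, Rmax_right in Hu by lra.
    assert (Hle : ln (1 + u) + ln (1 - u) <= 0).
    { rewrite <- ln_mult, <- ln_1 by lra.
      destruct (Req_dec u 0) as [->|Hu0]; [apply Req_le; f_equal; ring|].
      apply Rlt_le, ln_increasing; nra. }
    unfold f in Heq. rewrite Rplus_0_r, Rminus_0_r, ln_1 in Heq. nra.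
Qed.

(** With [t = 1 / (2 n + 1)], one has [1 + 1 / n = (1 + t) / (1 - t)], and the
    logarithm of the left-hand side is that of [ln_entropy_le] divided by
    [2 t]. *)
Lemma pow_midpoint_le_exp_1 (n : nat) :
  (0 < n)%nat ->
  (1 + / INR n) ^ n * (2 * (INR n + 1) / (2 * INR n + 1)) <= exp 1.
Proof.
  intros Hn. assert (Hn0 : 1 <= INR n) by (apply (le_INR 1); lia).
  set (t := / (2 * INR n + 1)).
  assert (Ht0 : 0 < t) by (apply Rinv_0_lt_compat; lra).
  assert (Ht : 0 <= t < 1).
  { split; [lra|]. unfold t. rewrite <- Rinv_1. apply Rinv_lt_contravar; lra. }
  assert (Hent := ln_entropy_le t Ht).
  replace (1 + / INR n) with ((1 + t) / (1 - t)) by (unfold t; field; lra).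
  replace (2 * (INR n + 1) / (2 * INR n + 1)) with (1 + t) by (unfold t; field; lra).
  assert (H1 : 0 < (1 + t) / (1 - t)) by (apply Rdiv_lt_0_compat; lra).
  rewrite <- (exp_ln (((1 + t) / (1 - t)) ^ n * (1 + t)))
    by (apply Rmult_lt_0_compat; [now apply pow_lt|lra]).
  assert (Hln : ln (((1 + t) / (1 - t)) ^ n * (1 + t)) <= 1).
  { rewrite ln_mult, ln_pow, ln_div by (try apply pow_lt; lra).
    replace (INR n) with ((1 - t) / (2 * t)) by (unfold t; field; lra).
    apply Rmult_le_reg_l with (2 * t); [lra|].
    replace (2 * t * ((1 - t) / (2 * t) * (ln (1 + t) - ln (1 - t)) + ln (1 + t)))
      with ((1 + t) * ln (1 + t) - (1 - t) * ln (1 - t)) by (field; lra).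
    lra. }
  destruct Hln as [Hln | ->]; [apply Rlt_le, exp_increasing, Hln|lra].
Qed.

Lemma norm_pow_le {V : NormedModule C_AbsRing}
    (A : V -> V) (Rz : C -> V -> V) (P : R) (n : nat) (x : V) :
  is_linear A ->
  (forall l, 1 < Cmod l -> is_resolvent A l (Rz l)) ->
  0 <= P ->
  (forall l z, 1 < Cmod l -> dist_pm1 l * norm (Rz l z) <= P * norm z) ->
  norm (op_pow A n x) <= exp 1 * P ^ 2 * norm x.
Proof.
  intros hA HR HP0 HP.
  assert (Hc : forall c, c <= exp 1 -> c * P ^ 2 * norm x <= exp 1 * P ^ 2 * norm x).
  { intros c Hc. apply Rmult_le_compat_r; [apply norm_ge_0|].
    apply Rmult_le_compat_r; [apply pow2_ge_0|exact Hc]. }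
  destruct n as [|n'].
  - (* radius [2]: the constant [8 / 3] is the left-hand side of
       [pow_midpoint_le_exp_1] at [1] *)
    assert (H := norm_pow_le_radius A Rz P 2 0 x hA HR HP0 HP ltac:(lra)).
    assert (He := pow_midpoint_le_exp_1 1 ltac:(lia)).
    simpl in He. simpl INR in H. rewrite Rmult_1_l in H.
    eapply Rle_trans; [exact H|]. apply Hc. simpl. lra.
  - (* radius [1 + 1 / n] *)
    set (n := S n') in *.
    assert (Hn : 1 <= INR n) by (apply (le_INR 1); unfold n; lia).
    set (r := 1 + / INR n).
    assert (Hr : 1 < r) by (unfold r; assert (0 < / INR n) by (apply Rinv_0_lt_compat; lra); lra).
    assert (H := norm_pow_le_radius A Rz P r n x hA HR HP0 HP Hr).
    assert (He := pow_midpoint_le_exp_1 n ltac:(unfold n; lia)). fold r in He.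
    eapply Rle_trans; [|apply Hc; exact He].
    apply Rmult_le_reg_l with (INR (S n)); [apply lt_0_INR; lia|].
    eapply Rle_trans; [exact H|]. apply Req_le.
    rewrite pow_add, S_INR. unfold r at 2 3. generalize (r ^ n). intros q.
    field. repeat split; nra.
Qed.

(** * Operator norms and distances *)

Section Constants.

Context {V : CompleteNormedModule C_AbsRing}.

(** The operator norm of a bounded operator is finite and is its least
    Lipschitz constant. *)
Lemma op_norm_finite (T : V -> V) :
  is_linear T ->
  exists t, op_norm T = Finite t /\ 0 <= t /\
    (forall x, norm (T x) <= t * norm x) /\
    (forall c, 0 <= c -> (forall x, norm (T x) <= c * norm x) -> t <= c).
Proof.
  intros hT. unfold op_norm.
  set (E := fun r => exists x : V, norm x <= 1 /\ r = norm (T x)).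
  assert (Hub : forall c, 0 <= c -> (forall x, norm (T x) <= c * norm x) -> is_ub_Rbar E c).
  { intros c Hc H r [x [Hx ->]]. simpl. eapply Rle_trans; [apply H|].
    rewrite <- (Rmult_1_r c) at 2. now apply Rmult_le_compat_l. }
  assert (H0 : E 0).
  { exists zero. split.
    - eapply Rle_trans; [apply Req_le, (norm_zero (V := V))|lra].
    - symmetry. rewrite <- (norm_zero (V := V)). apply (f_equal norm), (linear_zero T hT). }
  destruct (Lub_Rbar_correct E) as [H1 H2].
  destruct (linear_norm T hT) as [c [Hc Hb]].
  assert (Hfin := H2 c (Hub c ltac:(lra) Hb)).
  assert (Hpos := H1 0 H0).
  destruct (Lub_Rbar E) as [t| |]; [|easy|easy].
  exists t. split; [reflexivity|]. split; [exact Hpos|]. split.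
  - intros x. destruct (Req_dec (norm x) 0) as [Hx|Hx].
    + rewrite Hx, (norm_eq_zero x Hx), Rmult_0_r.
      rewrite <- (norm_zero (V := V)). apply Req_le, (f_equal norm), (linear_zero T hT).
    + assert (Hx0 : 0 < norm x) by (assert (H := norm_ge_0 x); lra).
      set (c0 := / norm x).
      assert (Hc0 : 0 < c0) by (now apply Rinv_0_lt_compat).
      assert (Hscal : forall z : V, norm (scal (RtoC c0) z) = c0 * norm z).
      { intros z. eapply eq_trans; [apply (norm_scal_C (V := V))|].
        rewrite Cmod_R, Rabs_pos_eq; [reflexivity|lra]. }
      assert (HE : norm (T (scal (RtoC c0) x)) <= t).
      { apply (H1 (norm (T (scal (RtoC c0) x)))). eexists. split; [|reflexivity].
        rewrite Hscal. unfold c0. rewrite Rinv_l by exact Hx. lra. }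
      assert (HTs : T (scal (RtoC c0) x) = scal (RtoC c0) (T x)) by apply (linear_scal T hT).
      rewrite HTs, Hscal in HE. unfold c0 in HE.
      apply Rmult_le_reg_l with (/ norm x); [now apply Rinv_0_lt_compat|].
      replace (/ norm x * (t * norm x)) with t by (field; exact Hx). exact HE.
  - intros d Hd Hdb. apply (H2 d (Hub d Hd Hdb)).
Qed.

(** The distance to a nonempty set is a nonnegative real number. *)
Lemma dist_set_finite (l : C) (S : C -> Prop) :
  (exists s, S s) ->
  exists d, dist_set l S = Finite d /\ 0 <= d /\
    (forall s, S s -> d <= Cmod (l - s)) /\
    (forall b, (forall s, S s -> b <= Cmod (l - s)) -> b <= d).
Proof.
  intros [s0 Hs0]. unfold dist_set.
  set (E := fun r => exists s : C, S s /\ r = Cmod (l - s)).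
  destruct (Glb_Rbar_correct E) as [H1 H2].
  assert (Hlb : forall b : R, (forall s, S s -> b <= Cmod (l - s)) -> is_lb_Rbar E b)
    by (intros b Hb r [s [Hs ->]]; now apply Hb).
  assert (Hup := H1 (Cmod (l - s0)) (ex_intro _ s0 (conj Hs0 eq_refl))).
  assert (Hpos := H2 0 (Hlb 0 (fun s _ => Cmod_ge_0 _))).
  destruct (Glb_Rbar E) as [d| |]; [|easy|easy].
  exists d. split; [reflexivity|]. split; [exact Hpos|]. split.
  - intros s Hs. apply (H1 (Cmod (l - s))). now exists s.
  - intros b Hb. exact (H2 b (Hlb b Hb)).
Qed.

Lemma dist_set_pair (l : C) : dist_set l pair_m1_1 = Finite (dist_pm1 l).
Proof.
  apply is_glb_Rbar_unique. split.
  - intros r [s [[-> | ->] ->]]; simpl; [apply Rmin_r|apply Rmin_l].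
  - intros b Hb. unfold dist_pm1, Rmin.
    destruct (Rle_dec _ _); apply Hb; eexists; split; try reflexivity;
      [right|left]; reflexivity.
Qed.

Lemma dist_pm1_le_sqrt2 (l : C) (t : R) :
  1 < Cmod l -> -1 <= t <= 1 -> dist_pm1 l <= sqrt 2 * Cmod (l - RtoC t).
Proof.
  intros Hl Ht.
  assert (H2 : sqrt 2 * sqrt 2 = 2) by (apply sqrt_sqrt; lra).
  assert (Hs0 := sqrt_pos 2).
  assert (Hsq : forall u, Cmod (l - RtoC u) ^ 2 <= 2 * Cmod (l - RtoC t) ^ 2 ->
    Cmod (l - RtoC u) <= sqrt 2 * Cmod (l - RtoC t)).
  { intros u Hu. assert (H3 := Cmod_ge_0 (l - RtoC t)).
    apply Rsqr_incr_0_var; [|now apply Rmult_le_pos].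
    unfold Rsqr. nra. }
  assert (Hl2 : 1 < Cmod l ^ 2) by nra.
  rewrite Cmod2_alt in Hl2. destruct l as [x y]. unfold Re, Im in Hl2.
  simpl fst in Hl2. simpl snd in Hl2.
  destruct (Rle_dec 0 x) as [Hx|Hx].
  - eapply Rle_trans; [apply Rmin_l|]. apply Hsq.
    rewrite !Cmod2_alt. unfold Re, Im. simpl. destruct (Rle_dec 1 x).
    + assert (0 <= (1 - t) * (x - 1)) by (apply Rmult_le_pos; lra).
      assert (0 <= (1 - t) * (1 - t)) by (apply Rmult_le_pos; lra). nra.
    + assert (0 <= x * (1 - x)) by (apply Rmult_le_pos; lra).
      assert (H3 := pow2_ge_0 (x - t)). nra.
  - eapply Rle_trans; [apply Rmin_r|]. apply Hsq.
    rewrite !Cmod2_alt. unfold Re, Im. simpl. destruct (Rle_dec x (-1)).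
    + assert (0 <= (1 + t) * (- 1 - x)) by (apply Rmult_le_pos; lra).
      assert (0 <= (1 + t) * (1 + t)) by (apply Rmult_le_pos; lra). nra.
    + assert (0 <= - x * (1 + x)) by (apply Rmult_le_pos; lra).
      assert (H3 := pow2_ge_0 (x - t)). nra.
Qed.

End Constants.

(** * Comparison of the constants *)

Section Comparison.

Context {V : CompleteNormedModule C_AbsRing}.

Lemma resolvent_spec (A : V -> V) (l : C) :
  ~ spectrum A l -> is_op_inverse (shift A l) (resolvent A l).
Proof.
  intros Hl. unfold resolvent. apply epsilon_spec.
  apply NNPP. exact Hl.
Qed.

Lemma not_segment_outside (l : C) : 1 < Cmod l -> ~ segment_m1_1 l.
Proof.
  intros Hl [t [Ht ->]]. rewrite Cmod_R in Hl.
  assert (H := Rabs_le t 1 Ht). lra.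
Qed.

Lemma P_const_ge (A : V -> V) (S : C -> Prop) (l : C) (d t : R) :
  1 < Cmod l -> dist_set l S = Finite d -> op_norm (resolvent A l) = Finite t ->
  Rbar_le (d * t) (P_const S A).
Proof.
  intros Hl Hd Ht. unfold P_const, Rbar_lub.
  destruct (Rbar_ex_lub _) as [p [Hub Hlub]]. simpl proj1_sig.
  apply Hub. exists l. split; [exact Hl|]. now rewrite Hd, Ht.
Qed.

(** A comparison of the distances outside the closed unit disk passes to the
    constants. *)
Lemma P_const_le (A : V -> V) (S1 S2 : C -> Prop) (c : R) :
  (forall l, 1 < Cmod l -> is_linear (resolvent A l)) ->
  (exists s, S1 s) -> (exists s, S2 s) -> 0 <= c ->
  (forall l d1 d2, 1 < Cmod l -> dist_set l S1 = Finite d1 ->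
     dist_set l S2 = Finite d2 -> d1 <= c * d2) ->
  forall p, P_const S2 A = Finite p -> Rbar_le (P_const S1 A) (c * p).
Proof.
  intros HL HS1 HS2 Hc Hd p Hp.
  unfold P_const at 1, Rbar_lub. destruct (Rbar_ex_lub _) as [p1 [Hub Hlub]]. simpl proj1_sig.
  apply Hlub. intros y [l [Hl ->]].
  destruct (op_norm_finite _ (HL l Hl)) as [t [Ht [Ht0 _]]].
  destruct (dist_set_finite l S1 HS1) as [d1 [Hd1 _]].
  destruct (dist_set_finite l S2 HS2) as [d2 [Hd2 _]].
  assert (H2 := P_const_ge A S2 l d2 t Hl Hd2 Ht). rewrite Hp in H2.
  specialize (Hd l d1 d2 Hl Hd1 Hd2).
  rewrite Hd1, Ht. simpl in *.
  apply Rle_trans with (c * d2 * t); [now apply Rmult_le_compat_r|].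
  rewrite Rmult_assoc. now apply Rmult_le_compat_l.
Qed.

Lemma P_const_nonneg (A : V -> V) (S : C -> Prop) :
  (forall l, 1 < Cmod l -> is_linear (resolvent A l)) ->
  (exists s, S s) -> Rbar_le 0 (P_const S A).
Proof.
  intros HL HS.
  assert (H2 : 1 < Cmod (RtoC 2)) by (rewrite Cmod_R, Rabs_pos_eq; lra).
  destruct (op_norm_finite _ (HL _ H2)) as [t [Ht [Ht0 _]]].
  destruct (dist_set_finite (RtoC 2) S HS) as [d [Hd [Hd0 _]]].
  eapply Rbar_le_trans; [|apply (P_const_ge A S _ d t H2 Hd Ht)].
  simpl. now apply Rmult_le_pos.
Qed.

End Comparison.

Theorem theorem3p2 (V : CompleteNormedModule C_AbsRing) (A : V -> V)
    (hA : is_linear A)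
    (hsp : forall z : C, spectrum A z <-> segment_m1_1 z) :
  Rbar_le (P_const (spectrum A) A) (P_const pair_m1_1 A) /\
  Rbar_le (M_const A)
    (Rbar_mult (Finite (exp 1))
      (Rbar_mult (P_const pair_m1_1 A) (P_const pair_m1_1 A))) /\
  Rbar_le
    (Rbar_mult (Finite (exp 1))
      (Rbar_mult (P_const pair_m1_1 A) (P_const pair_m1_1 A)))
    (Rbar_mult (Finite (2 * exp 1))
      (Rbar_mult (P_const (spectrum A) A) (P_const (spectrum A) A))).
Proof.
  assert (Hres : forall l, 1 < Cmod l -> is_op_inverse (shift A l) (resolvent A l)).
  { intros l Hl. apply resolvent_spec. rewrite hsp. now apply not_segment_outside. }
  assert (HL : forall l, 1 < Cmod l -> is_linear (resolvent A l))
    by (intros l Hl; apply (Hres l Hl)).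
  assert (Hpair : exists s, pair_m1_1 s) by (exists (RtoC 1); now right).
  assert (Hpm : forall t, -1 <= t <= 1 -> spectrum A (RtoC t))
    by (intros t Ht; apply hsp; now exists t).
  assert (Hspec : exists s, spectrum A s) by (exists (RtoC 1); apply Hpm; lra).
  assert (Hp0 := P_const_nonneg A pair_m1_1 HL Hpair).
  assert (Hq0 := P_const_nonneg A (spectrum A) HL Hspec).
  assert (He := exp_pos 1).
  repeat split.
  - destruct (P_const pair_m1_1 A) as [p| |] eqn:Hp; [|destruct (P_const (spectrum A) A); exact I|easy].
    replace p with (1 * p) by ring.
    apply (P_const_le A (spectrum A) pair_m1_1 1 HL Hspec Hpair ltac:(lra)); [|exact Hp].
    intros l d1 d2 Hl Hd1 Hd2. rewrite dist_set_pair in Hd2. injection Hd2 as <-.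
    destruct (dist_set_finite l (spectrum A) Hspec) as [d [Hd [_ [Hle _]]]].
    rewrite Hd in Hd1. injection Hd1 as <-. rewrite Rmult_1_l.
    apply Rmin_glb; apply Hle, Hpm; lra.
  - destruct (P_const pair_m1_1 A) as [p| |] eqn:Hp; [| |easy].
    + simpl in Hp0 |- *. unfold M_const. rewrite Rbar_sup_eq_lub.
      unfold Rbar_lub. destruct (Rbar_ex_lub _) as [M [Hub HM]]. simpl proj1_sig.
      apply HM. intros y [n ->].
      destruct (op_norm_finite (op_pow A n) (op_pow_linear A n hA)) as [t [Ht [_ [_ Hmin]]]].
      rewrite Ht. simpl. apply Hmin.
      { apply Rmult_le_pos; [lra|now apply Rmult_le_pos]. }
      intros x. replace (exp 1 * (p * p)) with (exp 1 * p ^ 2) by ring.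
      apply (norm_pow_le A (resolvent A) p n x hA).
      * intros l Hl. apply (Hres l Hl).
      * exact Hp0.
      * intros l z Hl.
        destruct (op_norm_finite _ (HL l Hl)) as [s [Hs [_ [Hsle _]]]].
        assert (Hge := P_const_ge A pair_m1_1 l _ s Hl (dist_set_pair l) Hs).
        rewrite Hp in Hge. simpl in Hge.
        assert (Hd := dist_pm1_ge l).
        apply Rle_trans with (dist_pm1 l * s * norm z).
        -- rewrite Rmult_assoc. apply Rmult_le_compat_l; [lra|apply Hsle].
        -- apply Rmult_le_compat_r; [apply (norm_ge_0 (V := V))|exact Hge].
    + simpl. destruct (Rle_dec 0 (exp 1)) as [H|H]; [|lra].
      destruct (Rle_lt_or_eq_dec 0 (exp 1) H) as [H'|H']; [|lra].
      destruct (M_const A); exact I.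
  - destruct (P_const (spectrum A) A) as [q| |] eqn:Hq; [| |easy].
    + assert (Hle : Rbar_le (P_const pair_m1_1 A) (sqrt 2 * q)).
      { apply (P_const_le A pair_m1_1 (spectrum A) (sqrt 2) HL Hpair Hspec (sqrt_pos 2));
          [|exact Hq].
        intros l d1 d2 Hl Hd1 Hd2. rewrite dist_set_pair in Hd1. injection Hd1 as <-.
        destruct (dist_set_finite l (spectrum A) Hspec) as [d [Hd [_ [_ Hge]]]].
        rewrite Hd in Hd2. injection Hd2 as <-.
        assert (Hs2 : 0 < sqrt 2) by (apply sqrt_lt_R0; lra).
        apply Rmult_le_reg_l with (/ sqrt 2); [now apply Rinv_0_lt_compat|].
        rewrite <- Rmult_assoc, Rinv_l, Rmult_1_l by lra.
        apply Hge. intros z Hz. apply hsp in Hz. destruct Hz as [t [Ht ->]].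
        apply Rmult_le_reg_l with (sqrt 2); [exact Hs2|].
        rewrite <- Rmult_assoc, Rinv_r, Rmult_1_l by lra.
        now apply dist_pm1_le_sqrt2. }
      destruct (P_const pair_m1_1 A) as [p| |]; [|easy|easy].
      simpl in *.
      assert (H2 : sqrt 2 * sqrt 2 = 2) by (apply sqrt_sqrt; lra).
      rewrite (Rmult_comm 2), Rmult_assoc. apply Rmult_le_compat_l; [lra|].
      apply Rle_trans with ((sqrt 2 * q) * (sqrt 2 * q)).
      * now apply Rmult_le_compat.
      * apply Req_le. transitivity (sqrt 2 * sqrt 2 * (q * q)); [ring|].
        rewrite H2. ring.
    + simpl (Rbar_mult p_infty p_infty).
      replace (Rbar_mult (2 * exp 1) p_infty) with p_infty.
      * destruct (Rbar_mult _ _); exact I.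
      * symmetry. apply is_Rbar_mult_unique, is_Rbar_mult_sym, is_Rbar_mult_p_infty_pos.
        simpl. lra.
Qed.
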